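(* Let $\mathbb{A}=(A_1,\dots,A_m)\in\mathbb{P}_n^m$ and $\omega=(w_1,\dots,w_m)\in\Delta_m$. If $Y\in\Gamma(\omega;\mathbb{A})$ satisfies $Y\ge I$, then $$Y^{-1}\le P_t(\omega;\mathbb{A})\qquad\text{for all } t\in[1/2,1].$$
   Context: $\mathbb{P}_n$ is the set of $n\times n$ complex positive definite matrices; $\le$ is the Löwner order; $\Delta_m$ is the set of $\omega=(w_1,\dots,w_m)$ with $w_i>0$ and $\sum_i w_i=1$. $A\sharp_tB=A^{1/2}(A^{-1/2}BA^{-1/2})^{t}A^{1/2}$ and $A\sharp B=A\sharp_{1/2}B$. The Karcher mean $\Lambda(\omega;A_1,\dots,A_m)$ is the unique $X\in\mathbb{P}_n$ with $\sum_i w_i\log(X^{-1/2}A_iX^{-1/2})=0$. Define $$\Gamma(\omega;\mathbb{A})=\{X\in\mathbb{P}_n:\Lambda(\omega;A_1\sharp X^{-1},\dots,A_m\sharp X^{-1})=I\},$$ equivalently the set of $X\in\mathbb{P}_n$ with $\sum_i w_i\log(A_i\sharp X^{-1})=0$. For $t\in(0,1]$, the Lim–Pálfia power mean $P_t(\omega;\mathbb{A})$ is the unique $X\in\mathbb{P}_n$ satisfying $X=\sum_{i=1}^m w_i(X\sharp_tA_i)$. *)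

(* Defs.v *)
From mathcomp Require Export all_boot all_order all_algebra.
From mathcomp Require Export sesquilinear spectral.
From mathcomp Require Export boolp classical_sets reals exp.
From mathcomp Require Export complex.

Set Implicit Arguments.
Unset Strict Implicit.
Unset Printing Implicit Defensive.

Import Order.TTheory GRing.Theory Num.Theory.
Local Open Scope ring_scope.
Local Open Scope complex_scope.
Local Open Scope sesquilinear_scope.

Section PositiveMatrices.
Context {R : realType} {n : nat}.
Implicit Types A B X Y : 'M[R[i]]_n.

(* The order on R[i] is partial: 0 < z (resp. 0 <= z) entails that z is real. *)
Definition posdef A : Prop :=
  A \is hermsymmx /\
  forall v : 'cV[R[i]]_n, v != 0 -> 0 < (v ^t* *m A *m v) 0 0.

Definition psd A : Prop :=
  A \is hermsymmx /\
  forall v : 'cV[R[i]]_n, 0 <= (v ^t* *m A *m v) 0 0.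

Definition loewner_le A B : Prop := psd (B - A).

(* Continuous functional calculus: f(A) = U^-1 diag(f(d_1), ..., f(d_n)) U for
   the unitary diagonalization A = U^-1 diag(d_1, ..., d_n) U of spectral.v.
   When A is Hermitian the d_k are real, so taking real parts loses nothing,
   and the result does not depend on the diagonalization. *)
Definition mxfun (f : R -> R) A : 'M[R[i]]_n :=
  invmx (spectralmx A)
  *m diag_mx (map_mx (fun z => (f (complex.Re z))%:C) (spectral_diag A))
  *m spectralmx A.

Definition mxlog A := mxfun (@ln R) A.

Definition mxpow A (t : R) := mxfun (fun x => x `^ t) A.

Definition gmean (t : R) A B :=
  mxpow A 2^-1
  *m mxpow (mxpow A (- 2^-1) *m B *m mxpow A (- 2^-1)) t
  *m mxpow A 2^-1.

Section Means.
Context {m : nat}.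
Implicit Types (w : 'I_m -> R) (As : 'I_m -> 'M[R[i]]_n).

Definition prob_weight w : Prop := (forall i, 0 < w i) /\ \sum_i w i = 1.

(* For positive definite As and weights w (and 0 < t <= 1 for the power mean),
   these means are the unique elements of the sets below; xget
   selects such an element (it would return 0 on an empty set). *)
Definition karcher_set w As : set 'M[R[i]]_n :=
  [set X | posdef X /\
     \sum_i (w i)%:C
        *: mxlog (mxpow X (- 2^-1) *m As i *m mxpow X (- 2^-1)) = 0].

Definition karcher_mean w As : 'M[R[i]]_n := xget 0 (karcher_set w As).

Definition power_mean_set (t : R) w As : set 'M[R[i]]_n :=
  [set X | posdef X /\ X = \sum_i (w i)%:C *: gmean t X (As i)].

Definition power_mean (t : R) w As : 'M[R[i]]_n :=
  xget 0 (power_mean_set t w As).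

Definition Gamma w As : set 'M[R[i]]_n :=
  [set X | posdef X /\
     karcher_mean w (fun i => gmean 2^-1 (As i) (invmx X)) = 1%:M].

End Means.
End PositiveMatrices.

(* Main.v *)
From mathcomp Require Import topology function_spaces normedtype sequences.
From mathcomp Require Import ring lra.
Require Import Defs.
Import Order.TTheory GRing.Theory Num.Theory.
Import numFieldNormedType.Exports.
Local Open Scope classical_set_scope.
Local Open Scope ring_scope.
Local Open Scope complex_scope.
Local Open Scope sesquilinear_scope.
Set Implicit Arguments.
Unset Strict Implicit.
Unset Printing Implicit Defensive.

(** Put [Z = Y^-1], so that [Z <= I], and let [F X] be the sum of the
    [w_i (X #_t A_i)], whose fixed points are the power means.

    The heart of the matter is that [Z] is a subsolution, [Z <= F Z].  By
    hypothesis the [C_i = A_i # Z] satisfy [sum_i w_i log C_i = 0], and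
    [log x <= x - 1] turns this into [sum_i w_i C_i >= I >= Z]: this is
    [Z <= F Z] for [t = 1/2], because [A_i # Z = Z # A_i].  For larger [t],
    write [B_i = Z^(-1/2) A_i Z^(-1/2)] and use the tangent inequality
    [x^t >= 2 t x^(1/2) + (1 - 2 t)], valid for [t >= 1/2]; after conjugation by
    [Z^(1/2)] it reads [Z #_t A_i >= 2 t (Z # A_i) + (1 - 2 t) Z], and the
    weighted sum is at least [2 t I + (1 - 2 t) Z >= Z] (lemma [le_power_map]).

    It remains to pass from a subsolution to the fixed point.  The map [F] is
    monotone and homogeneous of degree [1 - t < 1].  Both facts come from
    [X #_t A = A #_(1-t) X] (lemma [gmean_sym]), which moves the variable to the
    place where the Loewner-Heinz inequality applies (lemma [loewner_heinz]).
    - Every fixed point [X] lies above [Z]: if [c] in (0, 1] is the largest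
      scalar with [c Z <= X], then [X = F X >= F (c Z) >= c^(1-t) Z], which
      forces [c = 1] (lemma [subsolution_le_fixpoint]).
    - A fixed point exists: the iterates of [F] from [Z] increase and are bounded
      by a scalar matrix, so they converge.  The limit is fixed because for every
      [e > 0] it lies below [1 + e] times some iterate, and [F] is monotone and
      subhomogeneous (lemma [power_map_fixpoint_exists]).

    Loewner-Heinz is proved by Pedersen's argument: the exponents [s] with
    [A^s <= B^s] form a closed set, containing 0 and 1, that is stable under
    midpoints. *)

(** * Adjoints and real quadratic forms *)

Section Adjoint.
Context {R : realType}.

Lemma adjmxM m n p (A : 'M[R[i]]_(m, n)) (B : 'M[R[i]]_(n, p)) :
  (A *m B)^t* = B^t* *m A^t*.
Proof. by rewrite trmx_mul map_mxM. Qed.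

Lemma adjmxE m n (A : 'M[R[i]]_(m, n)) i j : A^t* i j = Num.conj (A j i).
Proof. by rewrite !mxE. Qed.

Lemma adjmxD m n (A B : 'M[R[i]]_(m, n)) : (A + B)^t* = A^t* + B^t*.
Proof. by rewrite linearD /= map_mxD. Qed.

Lemma adjmxB m n (A B : 'M[R[i]]_(m, n)) : (A - B)^t* = A^t* - B^t*.
Proof. by rewrite linearB /= map_mxB. Qed.

Lemma adjmxZ m n (c : R) (A : 'M[R[i]]_(m, n)) : (c%:C *: A)^t* = c%:C *: A^t*.
Proof.
by apply/matrixP => i j; rewrite !mxE rmorphM /= conj_Creal // complex_real.
Qed.

Lemma adjmx1 n : (1%:M : 'M[R[i]]_n)^t* = 1%:M.
Proof. by rewrite trmx1 map_mx1. Qed.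

Lemma adjmx_sum m n (I : finType) (F : I -> 'M[R[i]]_(m, n)) :
  (\sum_i F i)^t* = \sum_i (F i)^t*.
Proof.
by elim/big_rec2: _ => [|i A B _ <-]; rewrite ?adjmxD // trmx0 map_mx0.
Qed.

Lemma hermsymmxP n (A : 'M[R[i]]_n) : (A \is hermsymmx) <-> A^t* = A.
Proof.
split => [/is_hermitianmxP|h]; first by rewrite expr0 scale1r => <-.
by apply/is_hermitianmxP; rewrite expr0 scale1r.
Qed.

End Adjoint.

Section RealInnerProduct.
Context {R : realType} {n : nat}.
Implicit Types (u v : 'cV[R[i]]_n) (c : R).

(** The real part of the Hermitian inner product: for Hermitian matrices it
    carries all the information of the complex one, and it makes quadratic forms
    real-valued. *)
Definition rdot u v : R := complex.Re ((u^t* *m v) 0 0).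

Lemma rdotE u v : rdot u v = complex.Re ((u^t* *m v) 0 0).
Proof. by []. Qed.

Lemma rdotDr u v1 v2 : rdot u (v1 + v2) = rdot u v1 + rdot u v2.
Proof. by rewrite /rdot mulmxDr mxE; case: (_ 0 0) (_ 0 0) => [a b] []. Qed.

Lemma rdotC u v : rdot u v = rdot v u.
Proof.
rewrite /rdot -[u in RHS]trmxCK -adjmxM adjmxE.
by case: (_ 0 0).
Qed.

Lemma rdotDl u1 u2 v : rdot (u1 + u2) v = rdot u1 v + rdot u2 v.
Proof. by rewrite rdotC rdotDr !(rdotC v). Qed.

Lemma rdotZr c u v : rdot u (c%:C *: v) = c * rdot u v.
Proof.
by rewrite /rdot -scalemxAr mxE; case: (_ 0 0) => a b; rewrite /= mul0r subr0.
Qed.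

Lemma rdotNr u v : rdot u (- v) = - rdot u v.
Proof. by rewrite /rdot mulmxN mxE; case: (_ 0 0). Qed.

Lemma rdotBr u v1 v2 : rdot u (v1 - v2) = rdot u v1 - rdot u v2.
Proof. by rewrite rdotDr rdotNr. Qed.

Lemma rdot_mull (M : 'M[R[i]]_n) u v : rdot (M *m u) v = rdot u (M^t* *m v).
Proof. by rewrite /rdot adjmxM mulmxA. Qed.

Lemma rdot0r u : rdot u 0 = 0.
Proof. by rewrite /rdot mulmx0 mxE. Qed.

Lemma rdot_sum u :
  rdot u u = \sum_i (complex.Re (u i 0) ^+ 2 + complex.Im (u i 0) ^+ 2).
Proof.
rewrite /rdot mxE raddf_sum; apply: eq_bigr => i _; rewrite adjmxE.
by case: (u i 0) => a b /=; rewrite mulNr opprK -!expr2.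
Qed.

Lemma rdot_ge0 u : 0 <= rdot u u.
Proof. by rewrite rdot_sum sumr_ge0 // => i _; rewrite addr_ge0 ?sqr_ge0. Qed.

Lemma rdot_gt0 u : u != 0 -> 0 < rdot u u.
Proof.
have sq_ge0 (z : R[i]) : 0 <= complex.Re z ^+ 2 + complex.Im z ^+ 2.
  by rewrite addr_ge0 ?sqr_ge0.
move=> /cV0Pn[i ui0]; rewrite rdot_sum (bigD1 i) //=.
rewrite ltr_pwDl ?sumr_ge0 // lt0r sq_ge0 andbT paddr_eq0 ?sqr_ge0 //.
by rewrite !sqrf_eq0; move: ui0; rewrite eq_complex.
Qed.

(** A bilinear substitute for Cauchy-Schwarz: [u - v] has nonnegative square. *)
Lemma rdot_amgm u v : 2 * rdot u v <= rdot u u + rdot v v.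
Proof.
have := rdot_ge0 (u - v); rewrite !rdotBr !(rdotC (u - v)) !rdotBr (rdotC v u).
by move: (rdot u v) (rdot u u) (rdot v v) => x y z; lra.
Qed.

End RealInnerProduct.

Opaque rdot.

Section QuadraticForm.
Context {R : realType} {n : nat}.
Implicit Types (A B E M : 'M[R[i]]_n) (u v : 'cV[R[i]]_n) (c : R).

Definition qform A v : R := rdot v (A *m v).

Lemma qformE A v : qform A v = rdot v (A *m v).
Proof. by []. Qed.

Lemma qformD A B v : qform (A + B) v = qform A v + qform B v.
Proof. by rewrite /qform mulmxDl rdotDr. Qed.

Lemma qformB A B v : qform (A - B) v = qform A v - qform B v.
Proof. by rewrite /qform mulmxBl rdotBr. Qed.

Lemma qformZ c A v : qform (c%:C *: A) v = c * qform A v.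
Proof. by rewrite /qform -scalemxAl rdotZr. Qed.

Lemma qform0 v : qform 0 v = 0.
Proof. by rewrite /qform mul0mx rdot0r. Qed.

Lemma qform_sum (I : finType) (F : I -> 'M[R[i]]_n) v :
  qform (\sum_i F i) v = \sum_i qform (F i) v.
Proof.
by elim/big_rec2: _ => [|i x B _ <-]; rewrite ?qform0 // qformD.
Qed.

Lemma qform_congr M A v : qform (M^t* *m A *m M) v = qform A (M *m v).
Proof. by rewrite /qform rdot_mull !mulmxA. Qed.

Lemma qform_herm A v :
  A^t* = A -> (v^t* *m A *m v) 0 0 = (qform A v)%:C.
Proof.
move=> hA; rewrite /qform rdotE mulmxA RRe_real //; apply/CrealP.
have E : (v^t* *m A *m v)^t* = v^t* *m A *m v.
  by rewrite !adjmxM trmxCK hA mulmxA.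
by rewrite -adjmxE E.
Qed.

Lemma psdE A : psd A <-> A^t* = A /\ forall v, 0 <= qform A v.
Proof.
split=> -[hA h]; have hA' : A^t* = A by first [exact: hA | exact/hermsymmxP].
  by split=> // v; have := h v; rewrite qform_herm // ler0c.
by split=> [|v]; [apply/hermsymmxP|rewrite qform_herm // ler0c].
Qed.

Lemma posdefE A :
  posdef A <-> A^t* = A /\ forall v, v != 0 -> 0 < qform A v.
Proof.
split=> -[hA h]; have hA' : A^t* = A by first [exact: hA | exact/hermsymmxP].
  by split=> // v /h; rewrite qform_herm // (ltcR 0).
by split=> [|v /h]; [apply/hermsymmxP|rewrite qform_herm // (ltcR 0)].
Qed.

Lemma loewner_leE A B : A^t* = A -> B^t* = B ->
  loewner_le A B <-> forall v, qform A v <= qform B v.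
Proof.
move=> hA hB; rewrite /loewner_le psdE adjmxB hA hB.
split=> [[_ h] v|h]; last first.
  by split; [|move=> v; rewrite qformB subr_ge0].
by have := h v; rewrite qformB subr_ge0.
Qed.

Lemma loewner_le_qform A B v : loewner_le A B -> qform A v <= qform B v.
Proof. by move=> /psdE[_ /(_ v)]; rewrite qformB subr_ge0. Qed.

Lemma loewner_le_refl A : loewner_le A A.
Proof.
apply/psdE; rewrite subrr trmx0 map_mx0; split=> // v.
by rewrite qform0.
Qed.

Lemma loewner_le_trans B A C : loewner_le A B -> loewner_le B C -> loewner_le A C.
Proof.
move=> /psdE[h1 k1] /psdE[h2 k2]; apply/psdE.
have -> : C - A = (C - B) + (B - A) by rewrite addrA subrK.
split=> [|v]; last by rewrite qformD addr_ge0.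
by rewrite adjmxD h1 h2.
Qed.

Lemma loewner_le_congr M A B :
  loewner_le A B -> loewner_le (M^t* *m A *m M) (M^t* *m B *m M).
Proof.
move=> /psdE[h k]; apply/psdE; rewrite -mulmxBl -mulmxBr.
by split=> [|v]; rewrite ?qform_congr // !adjmxM trmxCK h mulmxA.
Qed.

Lemma loewner_leZ c A B :
  0 <= c -> loewner_le A B -> loewner_le (c%:C *: A) (c%:C *: B).
Proof.
move=> c0 /psdE[h k]; apply/psdE; rewrite -scalerBr adjmxZ h.
by split; [|move=> v; rewrite qformZ mulr_ge0].
Qed.

Lemma loewner_le_sum (I : finType) (F G : I -> 'M[R[i]]_n) :
  (forall i, loewner_le (F i) (G i)) -> loewner_le (\sum_i F i) (\sum_i G i).
Proof.
move=> h; apply/psdE; rewrite -sumrB; split.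
  by rewrite adjmx_sum; apply: eq_bigr => i _; have /psdE[] := h i.
by move=> v; rewrite qform_sum sumr_ge0 // => i _; have /psdE[_] := h i; apply.
Qed.

Lemma posdef_herm A : posdef A -> A^t* = A.
Proof. by move=> /posdefE[]. Qed.

Lemma posdef_ge A B : posdef A -> loewner_le A B -> posdef B.
Proof.
move=> /posdefE[hA pA] AB; apply/posdefE; split.
  by have /psdE[+ _] := AB; rewrite adjmxB hA => /addIr.
by move=> v /pA /lt_le_trans; apply; apply: loewner_le_qform.
Qed.

Lemma posdef_congr M A : M \in unitmx -> posdef A -> posdef (M^t* *m A *m M).
Proof.
move=> uM /posdefE[hA pA]; apply/posdefE; split.
  by rewrite !adjmxM trmxCK hA mulmxA.
move=> v v0; rewrite qform_congr; apply: pA; apply: contra v0 => /eqP v0.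
by rewrite -[v](mulKmx uM) v0 mulmx0.
Qed.

Lemma qform_cross A u v : A^t* = A ->
  qform A (u + v) = qform A u + qform A v + 2 * rdot u (A *m v).
Proof.
move=> hA; rewrite /qform mulmxDr !rdotDr !rdotDl (rdotC v) rdot_mull hA .
by move: (rdot u _) (rdot u _) (rdot v _) => x y z; ring.
Qed.

Lemma posdef1 : posdef (1%:M : 'M[R[i]]_n).
Proof.
apply/posdefE; split=> [|v v0]; first exact: adjmx1.
by rewrite qformE mul1mx rdot_gt0.
Qed.

Lemma posdef_psd A : posdef A -> psd A.
Proof.
move=> /posdefE[hA pA]; apply/psdE; split; first exact: hA.
move=> v; have [->|v0] := eqVneq v 0; last exact/ltW/pA.
by rewrite qformE mulmx0 rdot0r.
Qed.

Lemma qform_scalar c v : qform (c%:C *: 1%:M) v = c * rdot v v.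
Proof. by rewrite qformZ qformE mul1mx. Qed.

End QuadraticForm.

(** * Functional calculus of Hermitian matrices *)

Section FunctionalCalculus.
Context {R : realType} {n : nat}.
Implicit Types (A B M U : 'M[R[i]]_n) (d e : 'rV[R]_n) (f g : R -> R).

Definition diagC d : 'M[R[i]]_n := diag_mx (map_mx (real_complex R) d).

Lemma adj_diagC d : (diagC d)^t* = diagC d.
Proof.
apply/matrixP => i j; rewrite !mxE rmorphMn /= conj_Creal ?complex_real //.
by rewrite eq_sym; case: eqP => [->|].
Qed.

Lemma qform_diagC d v :
  qform (diagC d) v =
  \sum_i d 0 i * (complex.Re (v i 0) ^+ 2 + complex.Im (v i 0) ^+ 2).
Proof.
rewrite /qform rdotE mxE raddf_sum; apply: eq_bigr => i _.
rewrite adjmxE mul_diag_mx !mxE; case: (v i 0) => a b /=; ring.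
Qed.

Lemma qform_diagC_delta d k : qform (diagC d) (delta_mx k 0) = d 0 k.
Proof.
rewrite qform_diagC (bigD1 k) //= big1 ?addr0 => [|i ik]; rewrite !mxE ?eqxx /=.
  by rewrite expr1n expr0n addr0 mulr1.
by rewrite (negPf ik) /= expr0n addr0 mulr0.
Qed.

(** Entrywise, the hypothesis says that [M i j] vanishes unless [d_j = e_i], in
    which case also [f d_j = f e_i]. *)
Lemma diag_intertwine f d e M :
  M *m diagC d = diagC e *m M ->
  M *m diagC (map_mx f d) = diagC (map_mx f e) *m M.
Proof.
move=> h; apply/matrixP => i j; have := congr1 (fun M : 'M_n => M i j) h.
rewrite /diagC !mul_mx_diag !mul_diag_mx !mxE.
have [->|M0] := eqVneq (M i j) 0; first by rewrite !mul0r !mulr0.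
by rewrite mulrC => /(mulIf M0) /complexI ->; rewrite mulrC.
Qed.

(** Packages the spectral theorem so that one diagonalization with real
    eigenvalues serves for every function [f] at once. *)
Lemma spectral_herm A : A^t* = A ->
  exists U d,
   [/\ U *m U^t* = 1%:M, U^t* *m U = 1%:M, A = U^t* *m diagC d *m U &
       forall f, mxfun f A = U^t* *m diagC (map_mx f d) *m U].
Proof.
move=> /hermsymmxP hA; set U := spectralmx A; set e := spectral_diag A.
have Uu : U \is unitarymx := spectral_unitarymx A.
have iU := invmx_unitary Uu.
have AE : A = invmx U *m diag_mx e *m U.
  by apply/orthomx_spectralP/hermitian_normalmx.
have eR : map_mx (real_complex R) (map_mx (@complex.Re R) e) = e.
  apply/rowP => j; rewrite !mxE RRe_real //.
  by have /mxOverP := hermitian_spectral_diag_real hA; apply.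
have UU : U *m U^t* = 1%:M by apply/unitarymxP.
exists U, (map_mx (@complex.Re R) e); split.
- exact: UU.
- exact: mulmx1C UU.
- by rewrite /diagC eR -iU.
- move=> f; rewrite /mxfun -/U -/e iU /diagC.
  suff <- : map_mx (fun z => (f (complex.Re z))%:C) e =
    map_mx (real_complex R) (map_mx f (map_mx (@complex.Re R) e)) by [].
  by rewrite -!map_mx_comp.
Qed.

(** Everything about the functional calculus that is independent of the chosen
    diagonalization follows from this naturality: it reduces, in eigenbases of [A]
    and [B], to the diagonal case. *)
Lemma mxfun_intertwine f A B M :
  A^t* = A -> B^t* = B -> M *m A = B *m M -> M *m mxfun f A = mxfun f B *m M.
Proof.
move=> /spectral_herm[U [d [UV VU AE ->]]] /spectral_herm[V [e [VW WV BE ->]]].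
rewrite AE BE => h.
have : (V *m M *m U^t*) *m diagC d = diagC e *m (V *m M *m U^t*).
  have := congr1 (fun X => V *m X *m U^t*) h.
  by rewrite !mulmxA VW mul1mx -!mulmxA UV mulmx1 !mulmxA.
move=> /(diag_intertwine f) /(congr1 (fun X => V^t* *m X *m U)).
by rewrite !mulmxA WV mul1mx -!mulmxA VU mulmx1 !mulmxA.
Qed.

Lemma mxfun_diagC f d : mxfun f (diagC d) = diagC (map_mx f d).
Proof.
have [U [e [UV VU DE ->]]] := spectral_herm (adj_diagC d).
have /(diag_intertwine f) : U *m diagC d = diagC e *m U.
  by rewrite DE !mulmxA UV mul1mx.
by rewrite -mulmxA => <-; rewrite mulmxA VU mul1mx.
Qed.

Lemma mxfun_unitary f U d : U^t* *m U = 1%:M ->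
  mxfun f (U^t* *m diagC d *m U) = U^t* *m diagC (map_mx f d) *m U.
Proof.
move=> VU; have UV := mulmx1C VU.
have : U *m (U^t* *m diagC d *m U) = diagC d *m U by rewrite !mulmxA UV mul1mx.
move=> /(mxfun_intertwine f); rewrite mxfun_diagC.
rewrite !adjmxM trmxCK adj_diagC mulmxA => /(_ erefl erefl) h.
by rewrite -[RHS]mulmxA -h mulmxA VU mul1mx.
Qed.

Lemma posdef_unitary U d : U^t* *m U = 1%:M ->
  posdef (U^t* *m diagC d *m U) <-> forall i, 0 < d 0 i.
Proof.
move=> VU; have UV := mulmx1C VU.
have /mulmx1_unit[_ uU] := VU.
split=> [/posdefE[_ h] i|h].
  have -> : d 0 i = qform (U^t* *m diagC d *m U) (U^t* *m delta_mx i 0).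
    by rewrite qform_congr mulmxA UV mul1mx qform_diagC_delta.
  apply: h; apply/eqP => /(congr1 (mulmx U)); rewrite mulmxA UV mul1mx mulmx0.
  by move/matrixP => /(_ i 0); rewrite !mxE !eqxx => /eqP; rewrite oner_eq0.
apply: posdef_congr => //; apply/posdefE; split; first exact: adj_diagC.
move=> v /cV0Pn[i vi0]; rewrite qform_diagC (bigD1 i) //=.
have sq_ge0 (z : R[i]) : 0 <= complex.Re z ^+ 2 + complex.Im z ^+ 2.
  by rewrite addr_ge0 ?sqr_ge0.
rewrite ltr_pwDl // ?sumr_ge0 // => [|j _]; last by rewrite mulr_ge0 // ltW.
rewrite mulr_gt0 // lt0r sq_ge0 andbT paddr_eq0 ?sqr_ge0 // !sqrf_eq0.
by move: vi0; rewrite eq_complex.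
Qed.

Lemma mxfun_herm f A : A^t* = A -> (mxfun f A)^t* = mxfun f A.
Proof.
move=> /spectral_herm[U [d [_ _ _ ->]]].
by rewrite !adjmxM trmxCK adj_diagC mulmxA.
Qed.

Lemma mxfun_comp f g A : A^t* = A -> mxfun f (mxfun g A) = mxfun (f \o g) A.
Proof.
move=> /spectral_herm[U [d [_ VU _ E]]].
by rewrite (E g) (E (f \o g)) (mxfun_unitary f _ VU) map_mx_comp.
Qed.

Lemma mxfunM f g A :
  A^t* = A -> mxfun f A *m mxfun g A = mxfun (fun x => f x * g x) A.
Proof.
move=> /spectral_herm[U [d [UV VU _ E]]].
rewrite (E f) (E g) (E (fun x => f x * g x)).
have <- : diagC (map_mx f d) *m diagC (map_mx g d) =
    diagC (map_mx (fun x => f x * g x) d).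
  rewrite /diagC mulmx_diag; congr diag_mx.
  by apply/rowP => i; rewrite !mxE rmorphM.
by rewrite -!mulmxA (mulmxA U) UV mul1mx.
Qed.

Lemma mxfun_affine a b f A : A^t* = A ->
  mxfun (fun x => a * f x + b) A = a%:C *: mxfun f A + b%:C *: 1%:M.
Proof.
move=> /spectral_herm[U [d [UV VU _ E]]].
rewrite (E f) (E (fun x => a * f x + b)).
have -> : diagC (map_mx (fun x => a * f x + b) d) =
  a%:C *: diagC (map_mx f d) + b%:C *: 1%:M.
  apply/matrixP => i j; rewrite !mxE; case: (i == j) => /=.
    by rewrite !mulr1n rmorphD rmorphM mulr1.
  by rewrite !mulr0n !mulr0 addr0.
by rewrite mulmxDr mulmxDl -!scalemxAr -!scalemxAl mulmx1 VU.
Qed.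

Lemma mxfun_id A : A^t* = A -> mxfun id A = A.
Proof.
move=> /spectral_herm[U [d [_ _ AE E]]]; rewrite (E id) [RHS]AE.
suff -> : map_mx id d = d by [].
by apply/rowP => i; rewrite mxE.
Qed.

Lemma mxfun_cst c A : A^t* = A -> mxfun (fun=> c) A = c%:C *: 1%:M.
Proof.
move=> hA; have := mxfun_affine 0 c id hA; rewrite scale0r add0r => <-.
have [U [d [_ _ _ E]]] := spectral_herm hA.
rewrite (E (fun=> c)) (E (fun x => 0 * id x + c)).
suff <- : map_mx (fun=> c) d = map_mx (fun x => 0 * id x + c) d by [].
by apply/rowP => i; rewrite !mxE mul0r add0r.
Qed.

Lemma spectral_posdef A : posdef A ->
  exists U d,
   [/\ U^t* *m U = 1%:M, forall i, 0 < d 0 i &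
       forall f, mxfun f A = U^t* *m diagC (map_mx f d) *m U].
Proof.
move=> pA; have [U [d [_ VU AE E]]] := spectral_herm (posdef_herm pA).
exists U, d; split; [exact: VU| |exact: E].
by apply/(posdef_unitary d VU); rewrite -AE.
Qed.

Lemma eq_mxfun_pos f g A :
  posdef A -> (forall x, 0 < x -> f x = g x) -> mxfun f A = mxfun g A.
Proof.
move=> /spectral_posdef[U [d [_ d0 E]]] h; rewrite (E f) (E g).
suff <- : map_mx f d = map_mx g d by [].
by apply/rowP => i; rewrite !mxE h.
Qed.

Lemma mxfun_le_pos f g A :
  posdef A -> (forall x, 0 < x -> f x <= g x) ->
  loewner_le (mxfun f A) (mxfun g A).
Proof.
move=> pA h; have hA := posdef_herm pA.
apply/(loewner_leE (mxfun_herm f hA) (mxfun_herm g hA)) => v.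
have [U [d [_ d0 E]]] := spectral_posdef pA; rewrite (E f) (E g).
rewrite !qform_congr !qform_diagC ler_sum // => i _; rewrite !mxE.
by rewrite ler_wpM2r ?h // addr_ge0 ?sqr_ge0.
Qed.

Lemma mxfun_posdef f A :
  posdef A -> (forall x, 0 < x -> 0 < f x) -> posdef (mxfun f A).
Proof.
move=> /spectral_posdef[U [d [VU d0 E]]] h; rewrite (E f).
by apply/(posdef_unitary _ VU) => i; rewrite mxE h.
Qed.

End FunctionalCalculus.

Opaque mxfun.

(** * Real powers of positive definite matrices *)

Section Powers.
Context {R : realType} {n : nat}.
Implicit Types (A B M X : 'M[R[i]]_n) (c s r t : R).

Lemma posdef_mxpow A s : posdef A -> posdef (mxpow A s).
Proof. by move=> pA; apply: mxfun_posdef => // x x0; exact: powR_gt0. Qed.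

Lemma mxpow_herm A s : posdef A -> (mxpow A s)^t* = mxpow A s.
Proof. by move=> /posdef_herm; exact: mxfun_herm. Qed.

Lemma mxpow0 A : posdef A -> mxpow A 0 = 1%:M.
Proof.
move=> pA; transitivity (mxfun (fun=> 1 : R) A).
  by apply: eq_mxfun_pos => // x _; exact: powRr0.
by rewrite (mxfun_cst _ (posdef_herm pA)) scale1r.
Qed.

Lemma mxpow1 A : posdef A -> mxpow A 1 = A.
Proof.
move=> pA; rewrite -[RHS](mxfun_id (posdef_herm pA)).
by apply: eq_mxfun_pos => // x x0; exact/powRr1/ltW.
Qed.

Lemma mxpowD A s r : posdef A -> mxpow A s *m mxpow A r = mxpow A (s + r).
Proof.
move=> pA; rewrite /mxpow (mxfunM _ _ (posdef_herm pA)).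
by apply: eq_mxfun_pos => // x x0; rewrite powRD ?(gt_eqF x0) ?implybT.
Qed.

Lemma mxpowM A s r : posdef A -> mxpow (mxpow A s) r = mxpow A (s * r).
Proof.
move=> pA; rewrite /mxpow (mxfun_comp _ _ (posdef_herm pA)).
by apply: eq_mxfun_pos => // x x0 /=; rewrite powRrM.
Qed.

Lemma mxpow_half A : posdef A -> mxpow A 2^-1 *m mxpow A 2^-1 = A.
Proof.
move=> pA; rewrite (mxpowD _ _ pA).
have -> : 2^-1 + 2^-1 = 1 :> R by lra.
exact: mxpow1.
Qed.

Lemma mxpowNr A s : posdef A -> mxpow A s *m mxpow A (- s) = 1%:M.
Proof. by move=> pA; rewrite mxpowD // subrr mxpow0. Qed.

Lemma mxpowNl A s : posdef A -> mxpow A (- s) *m mxpow A s = 1%:M.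
Proof. by move=> pA; rewrite mxpowD // addNr mxpow0. Qed.

Lemma mxpow_unit A s : posdef A -> mxpow A s \in unitmx.
Proof. by move=> pA; case: (mulmx1_unit (mxpowNr s pA)) => h _; exact: h. Qed.

Lemma posdef_unit A : posdef A -> A \in unitmx.
Proof. by move=> pA; rewrite -(mxpow1 pA) mxpow_unit. Qed.

Lemma mxpowN1 A : posdef A -> mxpow A (-1) = invmx A.
Proof.
move=> pA; have uA := posdef_unit pA; have := mxpowNl 1 pA; rewrite mxpow1 //.
by move=> /(congr1 (mulmx^~ (invmx A))); rewrite mulmxK // mul1mx.
Qed.

Lemma posdef_inv A : posdef A -> posdef (invmx A).
Proof. by move=> pA; rewrite -(mxpowN1 pA); exact: posdef_mxpow. Qed.

Lemma posdefZ c A : 0 < c -> posdef A -> posdef (c%:C *: A).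
Proof.
move=> c0 /posdefE[hA pA]; apply/posdefE; split; first by rewrite adjmxZ hA.
by move=> v v0; rewrite qformZ mulr_gt0 ?pA.
Qed.

Lemma mxpowZ c A s : 0 < c -> posdef A ->
  mxpow (c%:C *: A) s = (c `^ s)%:C *: mxpow A s.
Proof.
move=> c0 pA; have hA := posdef_herm pA.
have -> : c%:C *: A = mxfun (fun x => c * id x + 0) A.
  by rewrite mxfun_affine // mxfun_id // scale0r addr0.
have -> : (c `^ s)%:C *: mxpow A s = mxfun (fun x => c `^ s * x `^ s + 0) A.
  by rewrite mxfun_affine // scale0r addr0.
rewrite /mxpow (mxfun_comp _ _ hA); apply: eq_mxfun_pos => [|x x0 /=].
  exact: pA.
by rewrite !addr0 powRM // ltW.
Qed.

Lemma mxpow_1mx s : mxpow 1%:M s = 1%:M :> 'M[R[i]]_n.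
Proof.
by rewrite -{1}(mxpow0 posdef1) (mxpowM _ _ posdef1) mul0r (mxpow0 posdef1).
Qed.

Lemma mxpow_half_conj_inv A : posdef A ->
  mxpow A 2^-1 *m invmx A *m mxpow A 2^-1 = 1%:M.
Proof.
move=> pA; rewrite -(mxpowN1 pA) (mxpowD _ _ pA) (mxpowD _ _ pA).
have -> : 2^-1 + -1 + 2^-1 = 0 :> R by lra.
exact: mxpow0.
Qed.

Opaque mxpow.

Lemma posdef_conj_half A X s : posdef A -> posdef X ->
  posdef (mxpow A s *m X *m mxpow A s).
Proof.
move=> pA pX; rewrite -{1}(mxpow_herm s pA); apply: posdef_congr => //.
exact: mxpow_unit.
Qed.

Lemma loewner_le_conj A X X' s : posdef A -> loewner_le X X' ->
  loewner_le (mxpow A s *m X *m mxpow A s) (mxpow A s *m X' *m mxpow A s).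
Proof.
by move=> pA /(loewner_le_congr (mxpow A s)); rewrite mxpow_herm.
Qed.

(** The eigenvalues of the pencil are those of [B^(-1/2) A B^(-1/2)], and a
    Hermitian matrix is below the identity when its eigenvalues are at most 1. *)
Lemma loewner_le_pencil A B : A^t* = A -> posdef B ->
  (forall c (x : 'cV[R[i]]_n), x != 0 -> A *m x = c%:C *: (B *m x) -> c <= 1) ->
  loewner_le A B.
Proof.
move=> hA pB h.
have [S [T [ST TS SS hS hT]]] : exists S T, [/\ S *m T = 1%:M, T *m S = 1%:M,
    S *m S = B, S^t* = S & T^t* = T].
  exists (mxpow B 2^-1), (mxpow B (- 2^-1)); split.
  - exact: mxpowNr.
  - exact: mxpowNl.
  - exact: mxpow_half.
  - exact: mxpow_herm.
  - exact: mxpow_herm.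
have hM : (T *m A *m T)^t* = T *m A *m T by rewrite !adjmxM hT hA mulmxA.
have AE : A = S *m (T *m A *m T) *m S.
  by rewrite !mulmxA ST mul1mx -mulmxA TS mulmx1.
have [U [d [UV VU ME _]]] := spectral_herm hM.
have d1 i : d 0 i <= 1.
  apply: (h (d 0 i) (T *m (U^t* *m delta_mx i 0))).
    apply/eqP => /(congr1 (mulmx (U *m S))).
    rewrite mulmx0 !mulmxA -(mulmxA U) ST mulmx1 UV mul1mx.
    by move/matrixP => /(_ i 0); rewrite !mxE !eqxx => /eqP; rewrite oner_eq0.
  have De : diagC d *m delta_mx i 0 = (d 0 i)%:C *: delta_mx i 0 :> 'cV_n.
    apply/matrixP => j k; rewrite mul_diag_mx !mxE.
    by case: eqP => [->|_] //=; rewrite !mulr0.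
  have ATE y : A *m (T *m y) = S *m ((T *m A *m T) *m y) :> 'cV_n.
    by rewrite !mulmxA ST mul1mx.
  have BTE y : B *m (T *m y) = S *m y :> 'cV_n.
    by rewrite -SS -mulmxA (mulmxA S T) ST mul1mx.
  rewrite ATE BTE ME -!mulmxA (mulmxA U (U^t*)) UV mul1mx De.
  by rewrite -!scalemxAr.
have : loewner_le (T *m A *m T) 1%:M.
  apply/(loewner_leE hM (adjmx1 n)) => v.
  have -> : 1%:M = U^t* *m diagC (const_mx 1) *m U.
    have <- : 1%:M = diagC (const_mx 1) :> 'M[R[i]]_n.
      by apply/matrixP => i j; rewrite !mxE.
    by rewrite mulmx1 VU.
  rewrite ME.
  rewrite !qform_congr !qform_diagC ler_sum // => i _.
  by rewrite ler_wpM2r ?addr_ge0 ?sqr_ge0 // mxE.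
by move=> /(loewner_le_congr S); rewrite hS -AE mulmx1 SS.
Qed.

End Powers.

(** * The Loewner-Heinz inequality *)

(** Bisection: at stage [k] the point lies in an interval of length [2^-k] with
    both endpoints in [S]. *)
Lemma dyadic_density (R : realType) (S : set R) :
  S 0 -> S 1 -> (forall a b, S a -> S b -> S ((a + b) / 2)) ->
  (forall s, (forall e, 0 < e -> exists2 a, S a & `|s - a| < e) -> S s) ->
  forall s, 0 <= s <= 1 -> S s.
Proof.
move=> S0 S1 Smid Scl s s01; apply: Scl => e e0.
have step k : exists2 a, S a /\ S (a + 2^-1 ^+ k) & a <= s <= a + 2^-1 ^+ k.
  elim: k => [|k [a [Sa Sb] sab]].
    by exists 0; rewrite expr0 add0r.
  set h := 2^-1 ^+ k.+1; have hE : 2^-1 ^+ k = h + h.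
    by rewrite /h exprS; lra.
  have Sm : S (a + h) by have := Smid _ _ Sa Sb; rewrite hE; congr S; field.
  rewrite hE addrA in Sb sab.
  have [sm|ms] := leP s (a + h).
    by exists a; rewrite // sm andbT; case/andP: sab.
  by exists (a + h); rewrite // ltW //=; case/andP: sab.
have [k ke] : exists k, (2^-1 : R) ^+ k < e.
  exists (Num.bound e^-1).
  rewrite exprVn invf_plt ?posrE ?exprn_gt0 //.
  exact: upper_nthrootP.
have [a [Sa _] /andP[as_ sa]] := step k; exists a => //.
by rewrite ger0_norm ?subr_ge0 // ltrBlDl (le_lt_trans sa) // ltrD2l.
Qed.

Lemma cvg_sumr (R : realType) (I : finType) (T : Type) (F : set_system T)
    (f : I -> T -> R) (l : I -> R) :
  Filter F -> (forall i, f i x @[x --> F] --> l i) ->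
  \sum_i f i x @[x --> F] --> \sum_i l i.
Proof.
by move=> FF fl; apply: cvg_big => [|i _]; [exact: add_continuous|exact: fl].
Qed.

Section LoewnerHeinz.
Context {R : realType} {n : nat}.
Implicit Types (A B M X : 'M[R[i]]_n) (c s r t : R).

(** The midpoint step of Pedersen's proof, with [P, Q] standing for the powers of
    [A] and [S, T] for those of [B].  For an eigenvector [Q P x = c T S x] of the
    pencil, choose [z] with [T z = S x]; then
    [c |S x|^2 = <Q z, P x> <= (|Q z|^2 + |P x|^2) / 2 <= (|T z|^2 + |S x|^2) / 2],
    and the right-hand side is [|S x|^2]. *)
Lemma loewner_le_mixed_product (P Q S T : 'M[R[i]]_n) :
  P^t* = P -> Q^t* = Q -> S^t* = S -> T^t* = T -> S \in unitmx -> T \in unitmx ->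
  (Q *m P)^t* = Q *m P -> posdef (T *m S) ->
  loewner_le (P *m P) (S *m S) -> loewner_le (Q *m Q) (T *m T) ->
  loewner_le (Q *m P) (T *m S).
Proof.
move=> hP hQ hS hT uS uT hQP pTS PS QT.
apply: (loewner_le_pencil hQP pTS) => c x x0 QPx.
have [z Tz] : exists z, T *m z = S *m x.
  by exists (invmx T *m (S *m x)); rewrite mulKVmx.
have sqE (M : 'M[R[i]]_n) y : M^t* = M ->
    rdot (M *m y) (M *m y) = qform (M *m M) y.
  by move=> hM; rewrite rdot_mull hM qformE mulmxA.
have Sx_gt0 : 0 < rdot (S *m x) (S *m x).
  apply: rdot_gt0; apply: contra x0 => /eqP /(congr1 (mulmx (invmx S))).
  by rewrite mulKmx // mulmx0 => ->.
have cross : rdot (Q *m z) (P *m x) = c * rdot (S *m x) (S *m x).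
  rewrite rdot_mull hQ mulmxA QPx rdotZr -mulmxA.
  by rewrite -[in LHS]hT -rdot_mull Tz.
have h1 := rdot_amgm (Q *m z) (P *m x).
rewrite cross (sqE Q z hQ) (sqE P x hP) in h1.
have h2 := loewner_le_qform x PS; have h3 := loewner_le_qform z QT.
rewrite -(sqE S x hS) in h2; rewrite -(sqE T z hT) Tz in h3.
(* The claim [c <= 1] is tested after multiplication by [|S x|^2 > 0]. *)
rewrite -(ler_pM2r Sx_gt0) mul1r.
move: (rdot (S *m x) _) (qform (P *m P) _) (qform (Q *m Q) _) h1 h2 h3.
by move=> a b d; lra.
Qed.

Lemma loewner_heinz_midpoint A B s r : posdef A -> posdef B ->
  loewner_le (mxpow A s) (mxpow B s) -> loewner_le (mxpow A r) (mxpow B r) ->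
  loewner_le (mxpow A ((s + r) / 2)) (mxpow B ((s + r) / 2)).
Proof.
move=> pA pB hs hr.
have half t (C : 'M[R[i]]_n) : posdef C ->
    mxpow C t = mxpow C (t / 2) *m mxpow C (t / 2).
  by move=> pC; rewrite (mxpowD _ _ pC) -splitr.
have mid (C : 'M[R[i]]_n) : posdef C ->
    mxpow C ((s + r) / 2) = mxpow C (r / 2) *m mxpow C (s / 2).
  by move=> pC; rewrite (mxpowD _ _ pC) -mulrDl addrC.
have hA := mxpow_herm ((s + r) / 2) pA; have hB := posdef_mxpow ((s + r) / 2) pB.
rewrite (half s A pA) (half s B pB) in hs.
rewrite (half r A pA) (half r B pB) in hr.
rewrite (mid A pA) (mid B pB) in hA hB *.
exact: (loewner_le_mixed_product (mxpow_herm _ pA) (mxpow_herm _ pA)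
  (mxpow_herm _ pB) (mxpow_herm _ pB) (mxpow_unit _ pB) (mxpow_unit _ pB)
  hA hB hs hr).
Qed.

Lemma powR_exponent_continuous (x : R) : 0 < x -> continuous (fun s : R => x `^ s).
Proof.
move=> x0 s; rewrite /powR gt_eqF //.
apply: (@continuous_comp R R R (fun s => s * ln x) (@expR R)).
  by apply: mulrr_continuous.
exact: continuous_expR.
Qed.

(** In an eigenbasis the form is a finite sum of real exponentials of [s]. *)
Lemma qform_mxpow_continuous A v : posdef A ->
  continuous (fun s : R => qform (mxpow A s) v).
Proof.
move=> /spectral_posdef[U [d [VU d0 E]]].
have -> : (fun s : R => qform (mxpow A s) v) =
    fun s => \sum_i d 0 i `^ s * (complex.Re ((U *m v) i 0) ^+ 2 +
                                  complex.Im ((U *m v) i 0) ^+ 2).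
  apply/funext => s; rewrite /mxpow (E (fun x => x `^ s)) qform_congr.
  by rewrite qform_diagC; apply: eq_bigr => i _; rewrite mxE.
move=> s; apply: cvg_sumr => i; apply: cvgMr_tmp; exact: powR_exponent_continuous.
Qed.

Lemma loewner_heinz A B t : posdef A -> posdef B -> loewner_le A B ->
  0 <= t <= 1 -> loewner_le (mxpow A t) (mxpow B t).
Proof.
move=> pA pB AB; move: t; apply: dyadic_density => [|| s r | s h].
- rewrite (mxpow0 pA) (mxpow0 pB); exact: loewner_le_refl.
- by rewrite (mxpow1 pA) (mxpow1 pB).
- exact: (loewner_heinz_midpoint pA pB).
have hA := mxpow_herm s pA; have hB := mxpow_herm s pB.
apply/(loewner_leE hA hB) => v; rewrite leNgt; apply/negP => lt.
have cAB : {for s, continuous (fun s : R => qform (mxpow B s) v - qform (mxpow A s) v)}.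
  by apply: continuousB; exact: qform_mxpow_continuous.
rewrite -subr_lt0 in lt.
have /(cvgr_lt _) := cAB; move=> /(_ _ lt).
move=> /nbhs_ballP[e /= e0 he].
have [a Sa sa] := h e e0.
have := he a sa; rewrite /= subr_lt0 ltNge; apply/negP/negPn.
exact: loewner_le_qform.
Qed.

End LoewnerHeinz.

Opaque mxpow qform mulmx.

(** * The weighted geometric mean *)

Section GeometricMean.
Context {R : realType} {n : nat}.
Implicit Types (A B M X : 'M[R[i]]_n) (c s r t : R).

(** With [a = A^(1/2)], [x = X^(1/2)] and [a', x'] their inverses, this is the
    noncommutative cancellation behind the symmetry of the mean; [Qt] and [Pmt]
    stand for [(x' A x')^t] and [(a' X a')^(-t)]. *)
Lemma gmean_symmetry_algebra (a a' x x' Qt Pmt : 'M[R[i]]_n) :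
  a *m a' = 1%:M -> a' *m a = 1%:M -> x *m x' = 1%:M ->
  Qt *m (x' *m a) = x' *m a *m Pmt ->
  x *m Qt *m x = a *m (Pmt *m (a' *m (x *m x) *m a')) *m a.
Proof.
move=> aa a'a xx QP.
have -> : x *m Qt *m x = x *m (Qt *m (x' *m a)) *m (a' *m x *m x).
  rewrite -!mulmxA; do 2 congr (_ *m _).
  rewrite (mulmxA a) aa mul1mx (mulmxA x').
  by rewrite (mulmx1C xx) mul1mx.
by rewrite QP !mulmxA xx mul1mx -!mulmxA a'a mulmx1.
Qed.

(** The matrix [K = X^(-1/2) A^(1/2)] intertwines the inverse of
    [P = A^(-1/2) X A^(-1/2)] with [Q = X^(-1/2) A X^(-1/2)], hence also their [t]-th
    powers. *)
Lemma gmean_sym t X A : posdef X -> posdef A ->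
  gmean t X A = gmean (1 - t) A X.
Proof.
move=> pX pA; rewrite /gmean.
have aa := mxpowNr 2^-1 pA; have a'a := mxpowNl 2^-1 pA.
have xx := mxpowNr 2^-1 pX.
have XE := mxpow_half pX; have AE := mxpow_half pA.
have pP := posdef_conj_half (- 2^-1) pA pX.
have pQ := posdef_conj_half (- 2^-1) pX pA.
move: (mxpow A 2^-1) (mxpow A (- 2^-1)) aa a'a AE pP pQ => a a' aa a'a AE.
move: (mxpow X 2^-1) (mxpow X (- 2^-1)) xx XE => x x' xx XE.
move EP : (a' *m X *m a') => P; move EQ : (x' *m A *m x') => Q pP pQ.
have PP : mxpow P (- t) *m P = mxpow P (1 - t).
  rewrite -{2}(mxpow1 pP) (mxpowD _ _ pP); congr mxpow; exact: addrC.
have PE : P = a' *m (x *m x) *m a' by rewrite XE EP.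
have -> : mxpow P (1 - t) = mxpow P (- t) *m (a' *m (x *m x) *m a').
  by rewrite -PE PP.
apply: (gmean_symmetry_algebra aa a'a xx).
have -> : mxpow P (- t) = mxpow (mxpow P (-1)) t.
  by have := mxpowM (-1) t pP; rewrite mulN1r => <-.
apply/esym; apply: mxfun_intertwine; first exact: mxpow_herm.
  exact: posdef_herm.
have PR : P *m mxpow P (-1) = 1%:M.
  by rewrite -{1}(mxpow1 pP) (mxpowNr _ pP).
have QKP : Q *m (x' *m a) *m P = x' *m a.
  rewrite -EQ -EP -AE -XE -!mulmxA (mulmxA a a') aa mul1mx.
  rewrite (mulmxA x' x) (mulmx1C xx) mul1mx.
  by rewrite (mulmxA x' x) (mulmx1C xx) mul1mx aa mulmx1.
by rewrite -{1}QKP -mulmxA PR mulmx1.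
Qed.

Lemma posdef_gmean t X A : posdef X -> posdef A -> posdef (gmean t X A).
Proof.
move=> pX pA; apply: (posdef_conj_half _ pX); apply: posdef_mxpow.
exact: posdef_conj_half.
Qed.

Lemma gmean_le_r t X A A' : posdef X -> posdef A -> posdef A' -> 0 <= t <= 1 ->
  loewner_le A A' -> loewner_le (gmean t X A) (gmean t X A').
Proof.
move=> pX pA pA' t01 AA; apply: (loewner_le_conj _ pX).
apply: loewner_heinz t01; [exact: posdef_conj_half|exact: posdef_conj_half|].
exact: loewner_le_conj.
Qed.

(** By symmetry this is monotonicity in the second argument for the exponent
    [1 - t]. *)
Lemma gmean_le_l t X X' A : posdef X -> posdef X' -> posdef A -> 0 <= t <= 1 ->
  loewner_le X X' -> loewner_le (gmean t X A) (gmean t X' A).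
Proof.
move=> pX pX' pA t01 XX; rewrite (gmean_sym t pX pA) (gmean_sym t pX' pA).
by apply: gmean_le_r => //; lra.
Qed.

Lemma gmeanZr t c X A : 0 < c -> posdef X -> posdef A ->
  gmean t X (c%:C *: A) = (c `^ t)%:C *: gmean t X A.
Proof.
move=> c0 pX pA; rewrite /gmean.
have := mxpowZ t c0 (posdef_conj_half (- 2^-1) pX pA).
move: (mxpow X 2^-1) (mxpow X (- 2^-1)) => x x' h.
have -> : x' *m (c%:C *: A) *m x' = c%:C *: (x' *m A *m x').
  by rewrite -scalemxAr -scalemxAl.
rewrite h; move: (mxpow _ _) => M; by rewrite -scalemxAr -scalemxAl.
Qed.

Lemma gmeanZl t c X A : 0 < c -> posdef X -> posdef A ->
  gmean t (c%:C *: X) A = (c `^ (1 - t))%:C *: gmean t X A.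
Proof.
move=> c0 pX pA; rewrite (gmean_sym t (posdefZ c0 pX) pA) (gmeanZr _ c0 pA pX).
by rewrite -(gmean_sym t pX pA).
Qed.

Lemma gmean_xx t X : posdef X -> gmean t X X = X.
Proof.
move=> pX; rewrite /gmean; have h := mxpow_half pX.
have xx := mxpowNr 2^-1 pX; move: (mxpow X 2^-1) (mxpow X (- 2^-1)) h xx.
move=> x x' h xx; have -> : x' *m X *m x' = 1%:M.
  by rewrite -h mulmxA (mulmx1C xx) mul1mx.
by rewrite mxpow_1mx mulmx1.
Qed.

End GeometricMean.

(** * Bounded increasing sequences of Hermitian matrices *)

Section MonotoneLimit.
Context {R : realType} {n : nat}.
Implicit Types (A B E M X : 'M[R[i]]_n) (c s r t : R) (v : 'cV[R[i]]_n).

Local Notation e_ k := (delta_mx k 0 : 'cV[R[i]]_n).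
Local Notation ie_ k := ('i *: delta_mx k 0 : 'cV[R[i]]_n).

Lemma adj_delta_col (i : 'I_n) : (e_ i)^t* = delta_mx 0 i.
Proof. by rewrite trmx_delta map_delta_mx. Qed.

Lemma rdot_delta M i j : rdot (e_ i) (M *m e_ j) = complex.Re (M i j).
Proof. by rewrite rdotE adj_delta_col -rowE -colE !mxE. Qed.

Lemma rdot_idelta M i j : rdot (e_ i) (M *m ie_ j) = - complex.Im (M i j).
Proof.
rewrite rdotE adj_delta_col -rowE -scalemxAr -colE !mxE.
by case: (M i j) => a b; rewrite /= mul0r mul1r sub0r.
Qed.

(** Together with [Im_polarization], recovers the entries of a Hermitian matrix
    from its quadratic form; the order and the limits below are only known through
    that form. *)
Lemma Re_polarization M i j : M^t* = M ->
  complex.Re (M i j) =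
  (qform M (e_ i + e_ j) - qform M (e_ i) - qform M (e_ j)) / 2.
Proof.
move=> /qform_cross ->; rewrite rdot_delta.
by move: (qform _ _) (qform _ _) => a b; field.
Qed.

Lemma Im_polarization M i j : M^t* = M ->
  complex.Im (M i j) =
  - ((qform M (e_ i + ie_ j) - qform M (e_ i) - qform M (ie_ j)) / 2).
Proof.
move=> /qform_cross ->; rewrite rdot_idelta.
by move: (qform _ _) (qform _ _) => a b; field.
Qed.

Lemma complex_eqP (x y : R[i]) :
  complex.Re x = complex.Re y -> complex.Im x = complex.Im y -> x = y.
Proof. by case: x y => [a b] [c d] /= -> ->. Qed.

Lemma loewner_le_anti A B : A^t* = A -> B^t* = B ->
  loewner_le A B -> loewner_le B A -> A = B.
Proof.
move=> hA hB AB BA.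
have E v : qform A v = qform B v.
  by apply/le_anti; rewrite !loewner_le_qform.
by apply/matrixP => i j; apply: complex_eqP;
  rewrite ?(Re_polarization _ _ hA) ?(Re_polarization _ _ hB)
          ?(Im_polarization _ _ hA) ?(Im_polarization _ _ hB) !E.
Qed.

Lemma qform_entries M v : qform M v =
  \sum_i \sum_j (complex.Re ((v i 0)^* * v j 0) * complex.Re (M i j)
               - complex.Im ((v i 0)^* * v j 0) * complex.Im (M i j)).
Proof.
rewrite qformE rdotE mxE raddf_sum; apply: eq_bigr => i _.
rewrite adjmxE mxE mulr_sumr raddf_sum; apply: eq_bigr => j _.
rewrite mulrCA; have ReM (x y : R[i]) : complex.Re (x * y) =
    complex.Re y * complex.Re x - complex.Im y * complex.Im x.
  by case: x y => [a b] [c d] /=; ring.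
exact: ReM.
Qed.

(** The values of the quadratic form converge by monotonicity; polarization
    transports this to the entries, which define the limit matrix. *)
Lemma loewner_monotone_limit (X_ : nat -> 'M[R[i]]_n) B :
  (forall k, (X_ k)^t* = X_ k) -> (forall k, loewner_le (X_ k) (X_ k.+1)) ->
  (forall k, loewner_le (X_ k) B) ->
  exists2 X, X^t* = X &
    forall v, qform (X_ k) v @[k --> \oo] --> qform X v.
Proof.
move=> hX X_inc X_le.
have cvq v : cvgn (fun k => qform (X_ k) v).
  apply: nondecreasing_is_cvgn.
    by apply/nondecreasing_seqP => k; exact: loewner_le_qform.
  by exists (qform B v) => _ [k _ <-]; exact: loewner_le_qform.
have [L cvL] : exists L, forall v, qform (X_ k) v @[k --> \oo] --> (L v : R).
  by exists (fun v => limn (fun k => qform (X_ k) v)) => v; exact: cvq.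
pose re i j := (L (e_ i + e_ j) - L (e_ i) - L (e_ j)) / 2.
pose im i j := - ((L (e_ i + ie_ j) - L (e_ i) - L (ie_ j)) / 2).
have cvRe i j : complex.Re (X_ k i j) @[k --> \oo] --> re i j.
  under eq_cvg => k do rewrite (Re_polarization _ _ (hX k)).
  by apply: cvgMr_tmp; apply: cvgB => //; apply: cvgB.
have cvIm i j : complex.Im (X_ k i j) @[k --> \oo] --> im i j.
  under eq_cvg => k do rewrite (Im_polarization _ _ (hX k)).
  by apply: cvgN; apply: cvgMr_tmp; apply: cvgB => //; apply: cvgB.
pose X : 'M[R[i]]_n := \matrix_(i, j) (re i j +i* im i j).
exists X; last first.
  move=> v; under eq_cvg => k do rewrite qform_entries.
  rewrite qform_entries; apply: cvg_sumr => i; apply: cvg_sumr => j.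
  by rewrite mxE; apply: cvgB; apply: cvgMl_tmp.
have Xconj k i j : X_ k j i = Num.conj (X_ k i j) by rewrite -adjmxE hX.
apply/matrixP => i j; rewrite adjmxE !mxE.
have reE : re j i = re i j.
  have Lc : L (e_ j + e_ i) = L (e_ i + e_ j) := congr1 L (addrC _ _).
  by rewrite /re Lc; move: (L _) (L _) (L _) => a b c; rewrite addrAC.
have imE : im j i = - im i j.
  have E : (fun k => complex.Im (X_ k j i)) = (fun k => - complex.Im (X_ k i j)).
    by apply/funext => k; rewrite Xconj; case: (X_ k i j).
  have := cvIm j i; rewrite E => h.
  have h' : - complex.Im (X_ k i j) @[k --> \oo] --> - im i j.
    exact: (cvgN (cvIm i j)).
  by rewrite -(cvg_lim (@Rhausdorff R) h) -(cvg_lim (@Rhausdorff R) h').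
by rewrite reE imE /= opprK.
Qed.

End MonotoneLimit.

(** * Scalar bounds and approximation from below *)

Section Bounds.
Context {R : realType} {n : nat}.
Implicit Types (A B E M X U : 'M[R[i]]_n) (c s r t : R) (v : 'cV[R[i]]_n).

(** The scalar is the trace of [A], which dominates each eigenvalue of [A]. *)
Lemma psd_le_trace A : psd A ->
  loewner_le A ((\sum_i qform A (delta_mx i 0))%:C *: 1%:M).
Proof.
move=> /psdE[hA A0]; have [U [d [UV VU AE _]]] := spectral_herm hA.
have d0 k : 0 <= d 0 k.
  have := A0 (U^t* *m delta_mx k 0).
  by rewrite AE qform_congr mulmxA UV mul1mx qform_diagC_delta.
have -> : \sum_i qform A (delta_mx i 0) = \sum_k d 0 k.
  transitivity (complex.Re (\tr A)).
    rewrite /mxtrace raddf_sum; apply: eq_bigr => k _.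
    by rewrite qformE rdot_delta.
  rewrite AE mxtrace_mulC mulmxA UV mul1mx mxtrace_diag raddf_sum.
  by apply: eq_bigr => k _; rewrite mxE.
apply/loewner_leE; [exact: hA|by rewrite adjmxZ adjmx1|move=> v].
rewrite qform_scalar AE qform_congr qform_diagC.
have -> : rdot v v = rdot (U *m v) (U *m v) by rewrite rdot_mull mulmxA VU mul1mx.
rewrite rdot_sum mulr_sumr ler_sum // => k _.
by rewrite ler_wpM2r ?addr_ge0 ?sqr_ge0 // (bigD1 k) //= lerDl sumr_ge0.
Qed.

Lemma posdef_le_scalar A : posdef A ->
  exists2 c, 0 < c & loewner_le A (c%:C *: 1%:M).
Proof.
move=> pA; have A0 := posdef_psd pA; have hA := posdef_herm pA.
set T := \sum_i qform A (delta_mx i 0).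
have T0 : 0 <= T by apply: sumr_ge0 => i _; have /psdE[_] := A0; apply.
exists (T + 1); first by rewrite ltr_wpDl.
apply: loewner_le_trans (psd_le_trace A0) _.
apply/loewner_leE; try by rewrite adjmxZ adjmx1.
by move=> v; rewrite !qform_scalar ler_wpM2r ?rdot_ge0 // lerDl.
Qed.

Lemma scalar_le_posdef A : posdef A ->
  exists2 c, 0 < c & loewner_le (c%:C *: 1%:M) A.
Proof.
move=> pA; have [c c0 h] := posdef_le_scalar (posdef_inv pA).
have := loewner_le_conj 2^-1 pA h.
rewrite (mxpow_half_conj_inv pA) -scalemxAr mulmx1 -scalemxAl (mxpow_half pA).
have ic0 : 0 <= c^-1 by rewrite invr_ge0 ltW.
move=> /(loewner_leZ ic0); rewrite scalerA -rmorphM /= mulVf ?gt_eqF //.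
by rewrite scale1r; exists c^-1; rewrite ?invr_gt0.
Qed.

Lemma invmx_le1 A : posdef A -> loewner_le 1%:M A -> loewner_le (invmx A) 1%:M.
Proof.
move=> pA h.
have E : mxpow A (- 2^-1) *m A *m mxpow A (- 2^-1) = 1%:M.
  rewrite -{2}(mxpow1 pA) (mxpowD _ _ pA) (mxpowD _ _ pA).
  have -> : - 2^-1 + 1 + - 2^-1 = 0 :> R by lra.
  exact: mxpow0.
have := loewner_le_conj (- 2^-1) pA h.
rewrite E mulmx1 (mxpowD _ _ pA).
have -> : - 2^-1 + - 2^-1 = -1 :> R by lra.
by rewrite (mxpowN1 pA).
Qed.

(** The traces of the [X - X_k] tend to 0, so [X - X_k] is eventually below
    [e c I], where [c I <= Z <= X_k]. *)
Lemma monotone_limit_approx (X_ : nat -> 'M[R[i]]_n) X Z e :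
  posdef Z -> (forall k, loewner_le Z (X_ k)) -> X^t* = X ->
  (forall k, (X_ k)^t* = X_ k) -> (forall k, loewner_le (X_ k) X) ->
  (forall v, qform (X_ k) v @[k --> \oo] --> qform X v) -> 0 < e ->
  exists k, loewner_le X ((1 + e)%:C *: X_ k).
Proof.
move=> pZ ZX hX hXk XkX cv e0.
have [c c0 cZ] := scalar_le_posdef pZ.
pose T k := \sum_i qform (X - X_ k) (delta_mx i 0).
have Ti i : qform (X - X_ k) (delta_mx i 0) @[k --> \oo] --> (0 : R).
  set q := qform X (delta_mx i 0); rewrite -(subrr q).
  have -> : (fun k => qform (X - X_ k) (delta_mx i 0)) =
      (fun k => q - qform (X_ k) (delta_mx i 0)).
    by apply/funext => k; exact: qformB.
  by apply: cvgB; [exact: cvg_cst|exact: cv].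
have T0 : T k @[k --> \oo] --> (\sum_(i < n) (0 : R)).
  exact: (cvg_sumr (f := fun i k => qform (X - X_ k) (delta_mx i 0))).
rewrite big1 // in T0.
have ec0 : 0 < e * c by rewrite mulr_gt0.
have /(cvgr_lt _)/(_ _ ec0)[k _ Tk] := T0.
exists k; apply/loewner_leE; [exact: hX|by rewrite adjmxZ hXk|move=> v].
have := loewner_le_qform v (psd_le_trace (XkX k)).
rewrite -/(T k) qform_scalar qformB qformZ => h.
have h1 : T k * rdot v v <= e * c * rdot v v.
  by rewrite ler_wpM2r ?rdot_ge0 // ltW // Tk /=.
have h2 : e * c * rdot v v <= e * qform (X_ k) v.
  have := loewner_le_qform v (loewner_le_trans cZ (ZX k)).
  by rewrite qform_scalar -mulrA => /(ler_wpM2l (ltW e0)).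
rewrite mulrDl mul1r -lerBlDl.
exact: le_trans h (le_trans h1 h2).
Qed.

End Bounds.

(** * Fixed points of the power mean map *)

Section PowerMap.
Context {R : realType} {n m : nat} (As : 'I_m -> 'M[R[i]]_n) (w : 'I_m -> R).
Context (t : R).
Context (pAs : forall i, posdef (As i)).
Context (w_ge0 : forall i, 0 <= w i).
Context (w_sum1 : \sum_i w i = 1).
Context (t01 : 0 <= t <= 1).
Implicit Types (A B E M X Z : 'M[R[i]]_n) (c : R) (v : 'cV[R[i]]_n).

Definition power_map X : 'M[R[i]]_n := \sum_i (w i)%:C *: gmean t X (As i).

Lemma qform_power_map X v :
  qform (power_map X) v = \sum_i w i * qform (gmean t X (As i)) v.
Proof. by rewrite /power_map qform_sum; apply: eq_bigr => i _; exact: qformZ. Qed.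

Lemma power_map_herm X : posdef X -> (power_map X)^t* = power_map X.
Proof.
move=> pX; rewrite /power_map adjmx_sum; apply: eq_bigr => i _.
by rewrite adjmxZ (posdef_herm (posdef_gmean t pX (pAs i))).
Qed.

Lemma power_map_le X X' : posdef X -> posdef X' -> loewner_le X X' ->
  loewner_le (power_map X) (power_map X').
Proof.
move=> pX pX' XX; apply: loewner_le_sum => i; apply: loewner_leZ; first exact: w_ge0.
exact: (gmean_le_l pX pX' (pAs i) t01 XX).
Qed.

Lemma power_mapZ c X : 0 < c -> posdef X ->
  power_map (c%:C *: X) = (c `^ (1 - t))%:C *: power_map X.
Proof.
move=> c0 pX; rewrite /power_map scaler_sumr; apply: eq_bigr => i _.
by rewrite (gmeanZl _ c0 pX (pAs i)) !scalerA mulrC.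
Qed.

Lemma power_map_le_scalar c :
  0 < c -> (forall i, loewner_le (As i) (c%:C *: 1%:M)) ->
  loewner_le (power_map (c%:C *: 1%:M)) (c%:C *: 1%:M).
Proof.
move=> c0 Ac; have pc := posdefZ c0 (@posdef1 R n).
apply/(loewner_leE (power_map_herm pc) (posdef_herm pc)) => v.
rewrite qform_power_map -[leRHS]mul1r -w_sum1 mulr_suml.
apply: ler_sum => i _; apply: ler_wpM2l; first exact: w_ge0.
rewrite -[in leRHS](gmean_xx t pc); apply: loewner_le_qform.
exact: (gmean_le_r pc (pAs i) pc t01 (Ac i)).
Qed.

(** The limit [X] of the increasing sequence of iterates from [Z] is fixed:
    [F X] dominates every iterate, hence [X]; and [X <= (1 + e) X_k] gives
    [F X <= (1 + e)^(1-t) X_(k+1) <= (1 + e) X] for every [e > 0]. *)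
Lemma power_map_fixpoint_exists Z c :
  posdef Z -> loewner_le Z (power_map Z) -> 0 < c ->
  loewner_le Z (c%:C *: 1%:M) -> (forall i, loewner_le (As i) (c%:C *: 1%:M)) ->
  exists X, posdef X /\ X = power_map X.
Proof.
move=> pZ Zf c0 Zc Ac; have pc := posdefZ c0 (@posdef1 R n).
have [X_ [X0 XS]] : exists X_ : nat -> 'M[R[i]]_n,
    X_ 0%N = Z /\ forall k, X_ k.+1 = power_map (X_ k).
  by exists (fun k => iter k power_map Z).
have step k : [/\ loewner_le Z (X_ k), loewner_le (X_ k) (X_ k.+1) &
                  loewner_le (X_ k) (c%:C *: 1%:M)].
  elim: k => [|k [ZX XX Xc]].
    by rewrite XS X0; split; [exact: loewner_le_refl|exact: Zf|exact: Zc].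
  have pX := posdef_ge pZ ZX; have pX1 := posdef_ge pX XX.
  split; first exact: loewner_le_trans ZX XX.
    rewrite (XS k.+1) {1}XS.
    exact: (power_map_le pX pX1 XX).
  rewrite XS.
  exact: loewner_le_trans (power_map_le pX pc Xc) (power_map_le_scalar c0 Ac).
have ZX k : loewner_le Z (X_ k) by have [] := step k.
have XX k : loewner_le (X_ k) (X_ k.+1) by have [] := step k.
have Xc k : loewner_le (X_ k) (c%:C *: 1%:M) by have [] := step k.
have pX k : posdef (X_ k) := posdef_ge pZ (ZX k).
have hX k := posdef_herm (pX k).
have [X hL cv] := loewner_monotone_limit hX XX Xc.
have XkX k : loewner_le (X_ k) X.
  apply/(loewner_leE (hX k) hL) => v.
  have inc : nondecreasing_seq (fun k => qform (X_ k) v).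
    by apply/nondecreasing_seqP => j; exact: (loewner_le_qform v (XX j)).
  have /(_ k) := nondecreasing_cvgn_le inc (cvgP _ (cv v)).
  by rewrite (cvg_lim (@Rhausdorff R) (cv v)).
have pL := posdef_ge (pX 0%N) (XkX 0%N).
exists X; split; first exact: pL.
have hfL := power_map_herm pL.
apply: (loewner_le_anti hL hfL).
  apply/(loewner_leE hL hfL) => v.
  apply: cvgr_to_le (cv v) _.
  apply: nearW => k; apply: loewner_le_qform.
  apply: loewner_le_trans (XX k) _; rewrite XS.
  exact: (power_map_le (pX k) pL (XkX k)).
apply/(loewner_leE hfL hL) => v.
have qL0 : 0 <= qform X v by have /psdE[_] := posdef_psd pL; apply.
have main e : 0 < e -> qform (power_map X) v <= (1 + e) * qform X v.
  move=> e0; have [k Xk] := monotone_limit_approx pZ ZX hL hX XkX cv e0.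
  have e1 : 0 < 1 + e by rewrite addr_gt0.
  have h1 := power_map_le pL (posdefZ e1 (pX k)) Xk.
  rewrite (power_mapZ e1 (pX k)) in h1.
  apply: le_trans (loewner_le_qform v h1) _; rewrite qformZ.
  have h2 : qform (power_map (X_ k)) v <= qform X v.
    by rewrite -XS; exact: loewner_le_qform (XkX k.+1).
  apply: le_trans (ler_wpM2l (powR_ge0 _ _) h2) _.
  apply: ler_wpM2r qL0 _ _ _; apply: ler1_powR; first by rewrite lerDl ltW.
  by case/andP: t01 => *; lra.
apply/ler_addgt0Pr => e e0.
have q1 : 0 < qform X v + 1 by rewrite ltr_wpDl.
apply: le_trans (main (e / (qform X v + 1)) (divr_gt0 e0 q1)) _.
by rewrite mulrDl mul1r lerD2l mulrAC ler_pdivrMr // ler_pM2l // lerDl ler01.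
Qed.

(** The supremum [s] of the [c <= 1] with [c Z <= X] is attained, and so is
    admissible [s^(1-t)]; this exceeds [s] unless [s = 1]. *)
Lemma subsolution_le_fixpoint Z X : posdef Z -> posdef X -> 0 < t ->
  loewner_le Z (power_map Z) -> X = power_map X -> loewner_le Z X.
Proof.
move=> pZ pX t0 Zf Xf; have hZ := posdef_herm pZ; have hX := posdef_herm pX.
pose S : set R := [set c | [/\ 0 < c, c <= 1 & loewner_le (c%:C *: Z) X]].
have [a a0 aX] := scalar_le_posdef pX.
have [b b0 bZ] := posdef_le_scalar pZ.
have S_neq0 : S !=set0.
  exists (Num.min 1 (a / b)); split; first by rewrite lt_min ltr01 divr_gt0.
    by rewrite ge_min lexx.
  apply: loewner_le_trans aX; set c := Num.min _ _.
  have c0 : 0 <= c by rewrite le_min ler01 ltW // divr_gt0.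
  apply: loewner_le_trans (loewner_leZ c0 bZ) _.
  rewrite scalerA -rmorphM /=.
  apply/loewner_leE; [by rewrite adjmxZ adjmx1|by rewrite adjmxZ adjmx1|move=> v].
  rewrite !qform_scalar ler_wpM2r ?rdot_ge0 // -ler_pdivlMr // ge_min lexx orbT.
  by [].
have S_ub : has_ubound S by exists 1 => c [].
have [c0 Sc0] := S_neq0; have [c0_gt0 _ _] := Sc0.
set s := sup S.
have s_ge c : S c -> c <= s by exact: ub_le_sup.
have s_gt0 : 0 < s := lt_le_trans c0_gt0 (s_ge _ Sc0).
have s_le1 : s <= 1 by apply: ge_sup => // c [].
have sX : loewner_le (s%:C *: Z) X.
  apply/(loewner_leE _ hX); first by rewrite adjmxZ hZ.
  move=> v; rewrite qformZ.
  have [->|v0] := eqVneq v 0; first by rewrite !qformE !mulmx0 !rdot0r mulr0.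
  have qZ : 0 < qform Z v by have /posdefE[_] := pZ; apply.
  rewrite -ler_pdivlMr //; apply: ge_sup => // c [_ _ /(loewner_le_qform v)].
  by rewrite qformZ ler_pdivlMr.
have S_pow : S (s `^ (1 - t)).
  split; first exact: powR_gt0.
    rewrite -[leRHS](powRr0 s); apply: ger_powR; first by rewrite s_gt0.
    by case/andP: t01 => _; rewrite subr_ge0.
  rewrite Xf; apply: loewner_le_trans (power_map_le (posdefZ s_gt0 pZ) pX sX).
  by rewrite (power_mapZ s_gt0 pZ); apply: loewner_leZ (powR_ge0 _ _) Zf.
have s1 : s = 1.
  apply/eqP; rewrite eq_le s_le1 /= leNgt; apply/negP => s_lt1.
  have st : s `^ t < 1.
    have -> : 1 = 1 `^ t :> R by rewrite powR1.
    by apply: gt0_ltr_powR; rewrite ?nnegrE ?ltW.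
  have := s_ge _ S_pow; apply/negP; rewrite -ltNge.
  have {1}-> : s = s `^ (1 - t) * s `^ t.
    by rewrite -powRD ?subrK ?powRr1 ?ltW // (gt_eqF s_gt0) implybT.
  by rewrite gtr_pMr // powR_gt0.
by move: sX; rewrite s1 scale1r.
Qed.

End PowerMap.

(** * The inverse of Y as a subsolution *)

(** Young's inequality for [y = x^(1/2)] and 1 with exponents [p = 2 t] and its
    conjugate: this is convexity of [y^p] at [y = 1]. *)
Lemma powR_ge_tangent (R : realType) (x t : R) : 0 < x -> 2^-1 <= t ->
  2 * t * x `^ 2^-1 + (1 - 2 * t) <= x `^ t.
Proof.
move=> x0 t_half; have y0 : 0 < x `^ 2^-1 by exact: powR_gt0.
have -> : x `^ t = (x `^ 2^-1) `^ (2 * t).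
  by rewrite -powRrM mulrA mulVf ?mul1r // pnatr_eq0.
move: (x `^ 2^-1) y0 => y y0.
have : 1 <= 2 * t by lra.
move: (2 * t) => p p1 {x x0 t t_half}.
have [->|p_neq1] := eqVneq p 1.
  by rewrite mul1r subrr addr0 powRr1 // ltW.
have p_gt1 : 1 < p by rewrite lt_neqAle eq_sym p_neq1.
have p0 : 0 < p by rewrite (lt_trans ltr01).
have pn0 : p != 0 by rewrite gt_eqF.
have pm0 : p - 1 != 0 by rewrite gt_eqF ?subr_gt0.
have q0 : 0 < p / (p - 1) by rewrite divr_gt0 ?subr_gt0.
have pq : p^-1 + (p / (p - 1))^-1 = 1.
  by field; rewrite ?pn0 ?pm0.
have := conjugate_powR (ltW y0) ler01 p0 q0 pq.
rewrite powR1 mulr1 => h.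
have {}h : p * y <= p * (y `^ p / p + 1 / (p / (p - 1))) by rewrite ler_pM2l.
have E : p * (y `^ p / p + 1 / (p / (p - 1))) = y `^ p + (p - 1).
  by field; rewrite ?pn0 ?pm0.
by rewrite E in h; lra.
Qed.

Section Subsolution.
Context {R : realType} {n m : nat} (As : 'I_m -> 'M[R[i]]_n) (w : 'I_m -> R).
Context (pAs : forall i, posdef (As i)).
Context (w_ge0 : forall i, 0 <= w i).
Context (w_sum1 : \sum_i w i = 1).
Implicit Types (A Z : 'M[R[i]]_n) (t : R) (v : 'cV[R[i]]_n).

Lemma mxlog_le_sub1 A v : posdef A -> qform (mxlog A) v <= qform A v - rdot v v.
Proof.
move=> pA; have hA := posdef_herm pA.
have h : loewner_le (mxlog A) (mxfun (fun x => 1 * id x + -1) A).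
  apply: (mxfun_le_pos pA) => x x0; rewrite mul1r.
  by have := @le_ln1Dx R (x - 1); rewrite addrCA subrr addr0; apply; lra.
have := loewner_le_qform v h.
rewrite (mxfun_affine _ _ _ hA) qformD qformZ (mxfun_id hA) mul1r.
by rewrite qform_scalar mulN1r.
Qed.

(** Apply [log x <= x - 1] to each [Cs i] and sum. *)
Lemma log_mean_zero_sum_ge Cs v : (forall i, posdef (Cs i)) ->
  \sum_i (w i)%:C *: mxlog (Cs i) = 0 :> 'M[R[i]]_n ->
  rdot v v <= \sum_i w i * qform (Cs i) v.
Proof.
move=> pC log0.
have : 0 <= \sum_i w i * (qform (Cs i) v - rdot v v).
  have := congr1 (fun M => qform M v) log0; rewrite /= qform0 qform_sum.
  move=> log0v; rewrite -[leLHS]log0v.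
  apply: ler_sum => i _; rewrite qformZ.
  by apply: ler_wpM2l; [exact: w_ge0|exact: mxlog_le_sub1].
under eq_bigr => i _ do rewrite mulrBr.
by rewrite sumrB -mulr_suml w_sum1 mul1r subr_ge0.
Qed.

(** [powR_ge_tangent] on the spectrum of [Z^(-1/2) A Z^(-1/2)], conjugated by
    [Z^(1/2)]. *)
Lemma gmean_ge_affine t Z A v : posdef Z -> posdef A -> 2^-1 <= t ->
  2 * t * qform (gmean 2^-1 Z A) v + (1 - 2 * t) * qform Z v
    <= qform (gmean t Z A) v.
Proof.
move=> pZ pA t_half.
have pB := posdef_conj_half (- 2^-1) pZ pA; have hB := posdef_herm pB.
rewrite /gmean; move: (mxpow Z (- 2^-1) *m A *m mxpow Z (- 2^-1)) pB hB => B pB hB.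
have h : loewner_le (mxfun (fun x => 2 * t * x `^ 2^-1 + (1 - 2 * t)) B) (mxpow B t).
  by apply: (mxfun_le_pos pB) => x x0; exact: powR_ge_tangent.
have aff : mxfun (fun x => 2 * t * x `^ 2^-1 + (1 - 2 * t)) B =
    (2 * t)%:C *: mxpow B 2^-1 + (1 - 2 * t)%:C *: 1%:M := mxfun_affine _ _ _ hB.
rewrite aff in h.
have E : mxpow Z 2^-1 *m ((2 * t)%:C *: mxpow B 2^-1 + (1 - 2 * t)%:C *: 1%:M)
      *m mxpow Z 2^-1 =
    (2 * t)%:C *: (mxpow Z 2^-1 *m mxpow B 2^-1 *m mxpow Z 2^-1)
      + (1 - 2 * t)%:C *: Z.
  by rewrite mulmxDr mulmxDl -!scalemxAr -!scalemxAl mulmx1 (mxpow_half pZ).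
have := loewner_le_qform v (loewner_le_conj 2^-1 pZ h).
by rewrite E qformD (qformZ (2 * t)) (qformZ (1 - 2 * t)).
Qed.

(** The weighted sum of the [Z # A_i] dominates the identity, and
    [gmean_ge_affine] extends the bound from [t = 1/2] to larger [t]. *)
Lemma le_power_map t Z : posdef Z -> loewner_le Z 1%:M ->
  \sum_i (w i)%:C *: mxlog (gmean 2^-1 (As i) Z) = 0 -> 2^-1 <= t ->
  loewner_le Z (power_map As w t Z).
Proof.
move=> pZ Z1 log0 t_half.
have hZ := posdef_herm pZ; have hf := power_map_herm w t pAs pZ.
apply/(loewner_leE hZ hf) => v; rewrite qform_power_map.
have pC i : posdef (gmean 2^-1 (As i) Z) := posdef_gmean 2^-1 (pAs i) pZ.
have CE i : gmean 2^-1 Z (As i) = gmean 2^-1 (As i) Z.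
  rewrite (gmean_sym _ pZ (pAs i)).
  by have -> : 1 - 2^-1 = 2^-1 :> R by lra.
have sumC : rdot v v <= \sum_i w i * qform (gmean 2^-1 Z (As i)) v.
  under eq_bigr => i _ do rewrite CE.
  exact: (log_mean_zero_sum_ge v pC log0).
have Zv : qform Z v <= rdot v v.
  by have := loewner_le_qform v Z1; rewrite [X in _ <= X]qformE mul1mx.
apply: le_trans (_ : \sum_i w i * (2 * t * qform (gmean 2^-1 Z (As i)) v
    + (1 - 2 * t) * qform Z v) <= _); last first.
  apply: ler_sum => i _; apply: ler_wpM2l; first exact: w_ge0.
  exact: (gmean_ge_affine v pZ (pAs i) t_half).
under eq_bigr => i _ do rewrite mulrDr mulrCA.
rewrite big_split /= -mulr_sumr -mulr_suml w_sum1 mul1r.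
have t0 : 0 <= 2 * t by lra.
have := ler_wpM2l t0 (le_trans Zv sumC).
move: (\sum_i _) (qform Z v) => a b; lra.
Qed.

End Subsolution.

(** In positive dimension the default value 0 of [xget] differs from the
    identity, so the identity really is a Karcher solution. *)
Lemma gamma_log_sum (R : realType) (n m : nat) (w : 'I_m -> R)
    (As : 'I_m -> 'M[R[i]]_n.+1) Y :
  Gamma w As Y ->
  \sum_i (w i)%:C *: mxlog (gmean 2^-1 (As i) (invmx Y)) = 0.
Proof.
move=> [_]; rewrite /karcher_mean; case: xgetP => [X -> [_ +] X1|_ /esym/eqP].
  rewrite X1 => h; rewrite -[RHS]h; apply: eq_bigr => i _.
  by rewrite mxpow_1mx mul1mx mulmx1.
by rewrite oner_eq0.
Qed.

Lemma dim0_loewner_le (R : realType) (A B : 'M[R[i]]_0) : loewner_le A B.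
Proof.
apply/psdE; split=> [|v]; first by rewrite [RHS]flatmx0 [LHS]flatmx0.
by rewrite qformE [v]flatmx0 mulmx0 rdot0r.
Qed.

Theorem theorem3p10 (R : realType) (n m : nat)
  (As : 'I_m -> 'M[R[i]]_n) (w : 'I_m -> R) (Y : 'M[R[i]]_n)
  (hA : forall i, posdef (As i)) (hw : prob_weight w)
  (hY : Gamma w As Y) (hYI : loewner_le 1%:M Y) (t : R)
  (ht : 2^-1 <= t <= 1) :
  loewner_le (invmx Y) (power_mean t w As).
Proof.
(* In dimension 0 the Karcher condition is void, but so is the conclusion. *)
case: n As Y hA hY hYI => [|n] As Y hA hY hYI; first exact: dim0_loewner_le.
have [w_gt0 w_sum1] := hw; have w_ge0 i : 0 <= w i := ltW (w_gt0 i).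
have [t_half t_le1] := andP ht.
have t0 : 0 < t by lra.
have t01 : 0 <= t <= 1 by rewrite ltW.
have pY : posdef Y by have [] := hY.
have pZ := posdef_inv pY; have Z1 := invmx_le1 pY hYI.
have Zf := le_power_map hA w_ge0 w_sum1 pZ Z1 (gamma_log_sum hY) t_half.
have [c c1 [Zc Ac]] : exists2 c : R, 0 < c &
    loewner_le (invmx Y) (c%:C *: 1%:M) /\
    forall i, loewner_le (As i) (c%:C *: 1%:M).
  have /fin_all_exists[b bP] i : exists c, 0 < c /\ loewner_le (As i) (c%:C *: 1%:M).
    by have [c c0 h] := posdef_le_scalar (hA i); exists c.
  have scal (x y : R) : x <= y ->
      loewner_le (x%:C *: 1%:M) (y%:C *: 1%:M : 'M[R[i]]_n.+1).
    move=> xy; apply/loewner_leE; [by rewrite adjmxZ adjmx1|by rewrite adjmxZ adjmx1|].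
    by move=> v; rewrite !qform_scalar ler_wpM2r ?rdot_ge0.
  have b0 i : 0 <= b i by have [/ltW] := bP i.
  exists (1 + \sum_i b i); first by rewrite ltr_pwDl ?sumr_ge0.
  split=> [|i].
    apply: loewner_le_trans Z1 _; rewrite -[X in loewner_le X](scale1r 1%:M).
    by apply: (scal 1); rewrite lerDl sumr_ge0.
  have [_ h] := bP i; apply: loewner_le_trans h _; apply: scal.
  by rewrite (bigD1 i) //= addrCA lerDl addr_ge0 ?sumr_ge0.
have [X0 [pX0 X0f]] :=
  power_map_fixpoint_exists hA w_ge0 w_sum1 t01 pZ Zf c1 Zc Ac.
have [pX Xf] : power_mean_set t w As (power_mean t w As).
  by apply: xgetPex; exists X0.
exact: (subsolution_le_fixpoint hA w_ge0 t01 pZ pX t0 Zf Xf).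
Qed.
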